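(* Let $\lambda\in\mathbb{C}\setminus\{0\}$ and let $f^n$ denote the $n$-th iterate of $f(z)=-2z^2$. If $f^n(\lambda)=i$ or $f^n(\lambda)=-i$ for some integer $n>1$, then $G_\lambda$ is simultaneously non-free and parabolic dust, and it contains at least two distinct subgroups isomorphic to $\mathbb{Z}\times\mathbb{Z}$.
   Context: For $\lambda\in\mathbb{C}\setminus\{0\}$, $G_\lambda=\langle S,T_\lambda\rangle$ is the subgroup of $PSL(2,\mathbb{C})$ generated by (the classes of) $S=\begin{pmatrix}1&0\\1&1\end{pmatrix}$ and $T_\lambda=\begin{pmatrix}1&2\lambda\\0&1\end{pmatrix}$. ''Non-free'' means that $G_\lambda$ is not a free group. $G_\lambda$ is not assumed discrete. If $G$ is a subgroup of $PSL(2,\mathbb{C})$, a parabolic element $h\in G$ is a primitive parabolic (of $G$) if $h=g^m$ with $g\in G$ and $m\in\mathbb{Z}$ implies $m=\pm1$. The group $G_\lambda$ (discrete or not) is called parabolic dust if it has a third conjugacy class of primitive parabolics, i.e. at least three conjugacy classes; here classes are counted as conjugacy classes in $G_\lambda$ of the cyclic subgroups generated by primitive parabolics, so that a parabolic and its inverse are not distinguished. *)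

(* Defs.v *)
From HB Require Import structures.
From mathcomp Require Import all_boot all_order all_algebra.
From mathcomp Require Import complex.
From mathcomp Require Import boolp classical_sets functions cardinality reals.
Set Implicit Arguments.
Unset Strict Implicit.
Unset Printing Implicit Defensive.
Import Order.TTheory GRing.Theory Num.Theory.

Local Open Scope classical_set_scope.
Local Open Scope ring_scope.

Section TwoByTwo.
Variable K : fieldType.

Definition mx2 (a b c d : K) : 'M[K]_2 :=
  \matrix_(i < 2, j < 2)
    if i == 0 then (if j == 0 then a else b) else (if j == 0 then c else d).

Lemma det_mx2 a b c d : \det (mx2 a b c d) = a * d - b * c.
Proof.
rewrite (expand_det_row _ 0) big_ord_recl big_ord1 /cofactor !det_mx11 !mxE /=.
by rewrite expr0 mul1r expr1 mulN1r mulrN.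
Qed.

Record SL2 := MkSL2 { SL2_mx :> 'M[K]_2; SL2_det : \det SL2_mx == 1 }.

HB.instance Definition _ := [isSub for SL2_mx].
HB.instance Definition _ := [Choice of SL2 by <:].

Lemma SL2_unit (A : SL2) : SL2_mx A \in unitmx.
Proof. by rewrite unitmxE (eqP (SL2_det A)) unitr1. Qed.

Fact SL2_one_det : \det (1%:M : 'M[K]_2) == 1.
Proof. by rewrite det1. Qed.

Fact SL2_mul_det (A B : SL2) : \det (A *m B) == 1.
Proof. by rewrite det_mulmx (eqP (SL2_det A)) (eqP (SL2_det B)) mulr1. Qed.

Fact SL2_inv_det (A : SL2) : \det (invmx A) == 1.
Proof. by rewrite det_inv (eqP (SL2_det A)) invr1. Qed.

Definition SL2_one : SL2 := MkSL2 SL2_one_det.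
Definition SL2_mul (A B : SL2) : SL2 := MkSL2 (SL2_mul_det A B).
Definition SL2_inv (A : SL2) : SL2 := MkSL2 (SL2_inv_det A).

Fact SL2_mulA : associative SL2_mul.
Proof. by move=> A B C; apply: val_inj; rewrite /= mulmxA. Qed.

Fact SL2_mul1 : left_id SL2_one SL2_mul.
Proof. by move=> A; apply: val_inj; rewrite /= mul1mx. Qed.

Fact SL2_mulr1 : right_id SL2_one SL2_mul.
Proof. by move=> A; apply: val_inj; rewrite /= mulmx1. Qed.

Fact SL2_mulV : left_inverse SL2_one SL2_inv SL2_mul.
Proof. by move=> A; apply: val_inj; rewrite /= mulVmx ?SL2_unit. Qed.

Fact SL2_mulrV : right_inverse SL2_one SL2_inv SL2_mul.
Proof. by move=> A; apply: val_inj; rewrite /= mulmxV ?SL2_unit. Qed.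

HB.instance Definition _ :=
  isGroup.Build SL2 SL2_mulA SL2_mul1 SL2_mulr1 SL2_mulV SL2_mulrV.

Definition SL2_pm (A B : SL2) : bool :=
  (SL2_mx A == SL2_mx B) || (SL2_mx A == - SL2_mx B).

Fact SL2_pm_refl : reflexive SL2_pm.
Proof. by move=> A; rewrite /SL2_pm eqxx. Qed.

Fact SL2_pm_sym : symmetric SL2_pm.
Proof. by move=> A B; rewrite /SL2_pm eq_sym -eqr_oppLR [- _ == _]eq_sym. Qed.

Fact SL2_pm_trans : transitive SL2_pm.
Proof.
move=> B A C; rewrite /SL2_pm => /orP[]/eqP-> // /orP[]/eqP->.
  by rewrite eqxx orbT.
by rewrite opprK eqxx.
Qed.

Canonical SL2_pm_equiv := EquivRel SL2_pm SL2_pm_refl SL2_pm_sym SL2_pm_trans.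

Local Open Scope quotient_scope.

Definition PSL2 := {eq_quot SL2_pm}.
HB.instance Definition _ := Choice.on PSL2.
HB.instance Definition _ := EqQuotient.on PSL2.

Lemma PSL2_eqP (A B : SL2) :
  reflect (SL2_mx A = SL2_mx B \/ SL2_mx A = - SL2_mx B)
          (\pi_PSL2 A == \pi_PSL2 B).
Proof.
by rewrite piE /= /SL2_pm; apply: (iffP orP) => -[]/eqP; [left|right|left|right].
Qed.

Lemma PSL2_repr (A : SL2) :
  SL2_mx (repr (\pi_PSL2 A)) = A \/ SL2_mx (repr (\pi_PSL2 A)) = - SL2_mx A.
Proof. by apply/PSL2_eqP; rewrite reprK. Qed.

Definition PSL2_one : PSL2 := \pi_PSL2 SL2_one.
Definition PSL2_mul (g h : PSL2) : PSL2 := \pi_PSL2 (SL2_mul (repr g) (repr h)).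
Definition PSL2_inv (g : PSL2) : PSL2 := \pi_PSL2 (SL2_inv (repr g)).

Lemma PSL2_mulE (A B : SL2) :
  PSL2_mul (\pi_PSL2 A) (\pi_PSL2 B) = \pi_PSL2 (SL2_mul A B).
Proof.
apply/eqP/PSL2_eqP => /=.
have [->|->] := PSL2_repr A; have [->|->] := PSL2_repr B;
  rewrite ?mulNmx ?mulmxN ?opprK; by [left|right].
Qed.

Lemma PSL2_invE (A : SL2) : PSL2_inv (\pi_PSL2 A) = \pi_PSL2 (SL2_inv A).
Proof.
apply/eqP/PSL2_eqP => /=.
have [->|->] := PSL2_repr A; first by left.
right; have uN : - SL2_mx A \in unitmx.
  by rewrite unitmxE -scaleN1r detZ (eqP (SL2_det A)) mulr1 unitrX // unitrN1.
apply: (can_inj (mulKmx uN)).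
by rewrite mulmxV // mulNmx mulmxN opprK mulmxV // SL2_unit.
Qed.

Fact PSL2_mulA : associative PSL2_mul.
Proof.
elim/quotW=> A; elim/quotW=> B; elim/quotW=> C.
rewrite (PSL2_mulE B C) (PSL2_mulE A B) (PSL2_mulE A (SL2_mul B C)) SL2_mulA.
by rewrite (PSL2_mulE (SL2_mul A B) C).
Qed.

Fact PSL2_mul1 : left_id PSL2_one PSL2_mul.
Proof. by elim/quotW=> A; rewrite (PSL2_mulE SL2_one A) SL2_mul1. Qed.

Fact PSL2_mulr1 : right_id PSL2_one PSL2_mul.
Proof. by elim/quotW=> A; rewrite (PSL2_mulE A SL2_one) SL2_mulr1. Qed.

Fact PSL2_mulV : left_inverse PSL2_one PSL2_inv PSL2_mul.
Proof. by elim/quotW=> A; rewrite PSL2_invE (PSL2_mulE (SL2_inv A) A) SL2_mulV. Qed.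

Fact PSL2_mulrV : right_inverse PSL2_one PSL2_inv PSL2_mul.
Proof. by elim/quotW=> A; rewrite PSL2_invE (PSL2_mulE A (SL2_inv A)) SL2_mulrV. Qed.

HB.instance Definition _ :=
  isGroup.Build PSL2 PSL2_mulA PSL2_mul1 PSL2_mulr1 PSL2_mulV PSL2_mulrV.

(* The trace of an element of PSL2 is defined up to sign, so its square does
   not depend on the representative. *)
Definition parabolic (g : PSL2) : Prop :=
  g != 1%g /\ (\tr (SL2_mx (repr g))) ^+ 2 = 4.

Lemma parabolic_pi (A : SL2) :
  parabolic (\pi_PSL2 A) <->
  [/\ SL2_mx A != 1%:M, SL2_mx A != - 1%:M & (\tr (SL2_mx A)) ^+ 2 = 4].
Proof.
have E1 : (\pi_PSL2 A != 1%g) = (SL2_mx A != 1%:M) && (SL2_mx A != - 1%:M).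
  rewrite -negb_or; congr (~~ _); apply/PSL2_eqP/orP => /=.
    by case=> ->; rewrite eqxx; [left|right].
  by case=> /eqP->; [left|right].
rewrite /parabolic E1; have [->|->] := PSL2_repr A; rewrite ?raddfN /= ?sqrrN.
  by split=> [[/andP[]]|[-> ->]].
by split=> [[/andP[]]|[-> ->]].
Qed.

End TwoByTwo.

Section GroupNotions.
Local Open Scope group_scope.
Variable gT : groupType.
Implicit Types (G H : set gT) (g h x y : gT) (w : seq (gT * bool)).

Definition is_subgroup H : Prop :=
  [/\ H 1, forall x y, H x -> H y -> H (x * y) & forall x, H x -> H x^-1].

Definition generated (X : set gT) : set gT := smallest is_subgroup X.

Definition zexpg g (m : int) : gT :=
  match m with Posz n => g ^+ n | Negz n => g ^- n.+1 end.

(* A word is a sequence of letters (x, b), with (x, false) standing for x and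
   (x, true) for x^-1; it is reduced when no letter is next to its inverse. *)
Definition word_val w : gT := \prod_(l <- w) (if l.2 then l.1^-1 else l.1).

Definition reduced w : bool :=
  sorted (fun l l' => ~~ ((l.1 == l'.1) && (l.2 != l'.2))) w.

Definition free_basis H (X : set gT) : Prop :=
  X `<=` H /\
  forall h, H h -> exists! w,
    [/\ reduced w, (forall l, l \in w -> X l.1) & word_val w = h].

Definition is_free H : Prop := exists X, free_basis H X.

Definition isomorphic_ZxZ H : Prop :=
  exists f : int * int -> gT,
    set_bij setT H f /\ forall a b, f (a + b)%R = f a * f b.

Definition cyclic_gen h : set gT := [set zexpg h m | m in setT].

(* x ^ g is the library's conjugate g^-1 * x * g, not a power. *)
Definition conj_set (C : set gT) g : set gT := [set x ^ g | x in C].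

Definition conj_class G (C : set gT) : set (set gT) :=
  [set conj_set C g | g in G].

End GroupNotions.

Section ParabolicDust.
Variable K : fieldType.
Implicit Types (G : set (PSL2 K)) (g h : PSL2 K).

Definition primitive_parabolic G h : Prop :=
  [/\ G h, parabolic h &
      forall g (m : int), G g -> h = zexpg g m -> m = 1 \/ m = -1].

(* Classes of cyclic subgroups rather than of elements: a parabolic and its
   inverse give the same class. *)
Definition primitive_parabolic_classes G : set (set (set (PSL2 K))) :=
  [set conj_class G (cyclic_gen h) | h in primitive_parabolic G].

Definition parabolic_dust G : Prop :=
  (`I_3 #<= primitive_parabolic_classes G)%card.

Fact gen_S_det : \det (mx2 1 0 1 1 : 'M[K]_2) == 1.
Proof. by rewrite det_mx2 mulr1 mul0r subr0. Qed.

Fact gen_T_det (lambda : K) : \det (mx2 1 (2 * lambda) 0 1) == 1.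
Proof. by rewrite det_mx2 mulr1 mulr0 subr0. Qed.

Definition gen_S : PSL2 K := (\pi_(PSL2 K) (MkSL2 gen_S_det))%qT.
Definition gen_T (lambda : K) : PSL2 K :=
  (\pi_(PSL2 K) (MkSL2 (gen_T_det lambda)))%qT.

Definition G_lambda (lambda : K) : set (PSL2 K) :=
  generated [set gen_S; gen_T lambda].

Definition quad_map (z : K) : K := - 2 * z ^+ 2.

End ParabolicDust.

(* Main.v *)
Require Import Defs.
From HB Require Import structures.
From mathcomp Require Import all_boot all_order all_algebra all_field.
From mathcomp Require Import complex zify ring.
From mathcomp Require Import boolp classical_sets functions cardinality reals.
Set Implicit Arguments.
Unset Strict Implicit.
Unset Printing Implicit Defensive.
Import Order.TTheory GRing.Theory Num.Theory.
Local Open Scope classical_set_scope.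
Local Open Scope ring_scope.

(** Write f for the quadratic map, and S, T for the generators of G_lambda.

    Passing from f lambda to lambda. Conjugation by a suitable matrix
    [1, 0; c, 1] fixes S and carries the second generator of G_(f lambda) to
    T S T^-1. Hence a conjugate of G_(f lambda) lies in G_lambda, and since the
    conjugator commutes with every lower unipotent matrix, each lower unipotent
    element of G_(f lambda) is itself an element of G_lambda
    (G_lambda_quad_map). By iteration the same holds for G_mu, where
    mu = f^(n-1) lambda satisfies f mu = +-i.

    A second translation. For such mu the number w = 2 mu satisfies w^4 = -4,
    so +-w = 1 + j with j^2 = -1, and G_mu is the group of the Whitehead link.
    There, besides the meridian S = [1, 0; 1, 1], the cusp group of S contains
    a word in S, T equal to [1, 0; u, 1] with u = 1 - 2j (longitude). As 1 and
    u are independent over the integers, G_lambda contains a group Z x Z, which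
    in turn has many subgroups isomorphic to Z x Z. In a free group two
    commuting elements, the first one nontrivial, satisfy h^n = g^m with n > 0
    (commute_free_basis); so G_lambda is not free.

    Three classes of primitive parabolics. They are S, T and [1, 0; u, 1]. With
    r = 2 lambda one has r^N = -4 for N = 2^(n+1), so the entries of G_lambda
    are algebraic integers, whether or not the group is discrete. The three
    elements are conjugates of lower unipotents with corner entry d = 1, -r, u
    under PSL2 of the algebraic integers.
    - If such an element is the m-th power of an element of G_lambda, the latter
      commutes with it, hence is unipotent with the same fixed point, and m
      divides d among algebraic integers (dvda_zexpg_root). The relations
      r^N = -4 and u u^* = 5 then force m = +-1.
    - If it is conjugate to a power of the one with corner d', it lies in the
      congruence subgroup of level d', so d' divides d (dvda_conj_zexpg). But r
      does not divide 1, and u divides neither 1 nor r: taking norms, -4 or 5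
      would divide 1, or 5^N would divide 16. *)

(** * Commuting elements of free groups *)

Section FreeGroups.
Local Open Scope group_scope.
Variable gT : groupType.
Implicit Types (l : gT * bool) (u v w : seq (gT * bool)) (g h x : gT).

Definition flip l := (l.1, ~~ l.2).
Definition winv w := rev (map flip w).

Lemma flipK : involutive flip.
Proof. by case=> x b; rewrite /flip negbK. Qed.

Lemma reducedE w : reduced w = sorted (fun l l' => l' != flip l) w.
Proof.
apply: eq_sorted => -[x b] [y c]; rewrite /flip /= xpair_eqE eq_sym.
by case: (y == x); case: b; case: c.
Qed.

Lemma reduced_catr u v : reduced (u ++ v) -> reduced v.
Proof. by rewrite !reducedE => /cat_sorted2[]. Qed.

Lemma reduced_catl u v : reduced (u ++ v) -> reduced u.
Proof. by rewrite !reducedE => /cat_sorted2[]. Qed.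

Lemma reduced_rcons_cons u l l' v :
  reduced (rcons u l ++ l' :: v) =
  [&& reduced (rcons u l), l' != flip l & reduced (l' :: v)].
Proof.
rewrite !reducedE; case: u => [|l0 u] //=.
by rewrite cat_path /= last_rcons.
Qed.

Lemma word_val_cat u v : word_val (u ++ v) = word_val u * word_val v.
Proof. exact: big_cat. Qed.

Lemma word_val1 l : word_val [:: l] = if l.2 then l.1^-1 else l.1.
Proof. exact: big_seq1. Qed.

Lemma winv_cat u v : winv (u ++ v) = winv v ++ winv u.
Proof. by rewrite /winv map_cat rev_cat. Qed.

Lemma winv_rcons u l : winv (rcons u l) = flip l :: winv u.
Proof. by rewrite /winv map_rcons rev_rcons. Qed.

Lemma word_val_winv u : word_val (winv u) = (word_val u)^-1.
Proof.
elim: u => [|l u IHu]; first by rewrite /winv /word_val !big_nil invg1.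
rewrite -cat1s winv_cat !word_val_cat IHu invgM; congr (_ * _).
by rewrite !word_val1 /=; case: l => x [] //=; rewrite invgK.
Qed.

Lemma reduced_winv u : reduced u -> reduced (winv u).
Proof.
rewrite !reducedE /winv rev_sorted sorted_map.
by apply: sub_sorted => l l'; rewrite /= (can_eq flipK) eq_sym (can2_eq flipK flipK).
Qed.

(** The product of two reduced words is reduced once a tail c of the first is
    cancelled against the head of the second. *)
Lemma reduced_cancel u v : reduced u -> reduced v ->
  exists a b c, [/\ u = a ++ c, v = winv c ++ b & reduced (a ++ b)].
Proof.
elim/last_ind: u v => [|u l IHu] v redu redv; first by exists [::], v, [::].
case: v redv => [|l' v] redv.
  by exists (rcons u l), [::], [::]; rewrite !cats0.
have [l'E|l'N] := eqVneq l' (flip l); last first.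
  exists (rcons u l), (l' :: v), [::]; rewrite cats0; split=> //.
  by rewrite reduced_rcons_cons redu l'N.
have redu' : reduced u by move: redu; rewrite -cats1 => /reduced_catl.
have redv' : reduced v by move: redv; rewrite -cat1s => /reduced_catr.
have [a [b [c [uE vE redab]]]] := IHu v redu' redv'.
exists a, b, (rcons c l); split=> //; first by rewrite uE rcons_cat.
by rewrite winv_rcons l'E vE.
Qed.

Section Basis.
Variables (H X : set gT).
Hypotheses (sgH : is_subgroup H) (HX : free_basis H X).

Let xword w := reduced w /\ (forall l, l \in w -> X l.1).

Let xword_cat u v : xword u -> xword v -> reduced (u ++ v) -> xword (u ++ v).
Proof.
move=> [_ Xu] [_ Xv] redw; split=> // l.
by rewrite mem_cat => /orP[/Xu|/Xv].
Qed.

Let xword_catl u v : xword (u ++ v) -> xword u.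
Proof.
move=> [/reduced_catl redu Xw]; split=> // l lu.
by apply: Xw; rewrite mem_cat lu.
Qed.

Let xword_catr u v : xword (u ++ v) -> xword v.
Proof.
move=> [/reduced_catr redu Xw]; split=> // l lu.
by apply: Xw; rewrite mem_cat lu orbT.
Qed.

Let xword_winv u : xword u -> xword (winv u).
Proof.
move=> [redu Xu]; split; first exact: reduced_winv.
by move=> l; rewrite mem_rev => /mapP[l' /Xu Xl' ->].
Qed.

Let word_valH u : xword u -> H (word_val u).
Proof.
have [H1 HM HV] := sgH.
elim: u => [|l u IHu] xu; first by rewrite /word_val big_nil.
move: (xu) => [_ Xu]; rewrite -cat1s word_val_cat; apply: HM; last first.
  by apply: IHu; apply: (xword_catr (u := [:: l])).
have Hl : H l.1 by apply: HX.1; apply: Xu; rewrite mem_head.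
by rewrite word_val1; case: ifP => // _; apply: HV.
Qed.

(** Uniqueness of the reduced expression of an element of H turns equalities in
    the group into equalities of words. *)
Let word_val_inj u v : xword u -> xword v -> word_val u = word_val v -> u = v.
Proof.
move=> xu xv uv; have [w [_ wP]] := HX.2 _ (word_valH xu).
move: xu xv => [redu Xu] [redv Xv].
by rewrite -(wP u) // -(wP v).
Qed.

Let word_ex h : H h -> exists2 w, xword w & word_val w = h.
Proof. by move=> /HX.2[w [[]]]; exists w. Qed.

(** No cancellation can occur in vu either: uv and vu represent the same element,
    so their reduced forms have the same length. *)
Let commute_cat u v : xword u -> xword v -> reduced (u ++ v) ->
  commute (word_val u) (word_val v) -> u ++ v = v ++ u.
Proof.
move=> xu xv redw cuv.
have [a [b [c [vE uE redab]]]] := reduced_cancel xv.1 xu.1.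
have abE : u ++ v = a ++ b.
  apply: word_val_inj; first exact: xword_cat.
    apply: xword_cat => //; first by move: xv; rewrite vE => /xword_catl.
    by move: xu; rewrite uE => /xword_catr.
  rewrite word_val_cat cuv vE uE !word_val_cat word_val_winv.
  by rewrite -mulgA mulVKg.
have c0 : c = [::].
  move/(congr1 size): abE; rewrite uE vE !size_cat /winv size_rev size_map.
  by case: (c) => //= *; lia.
by rewrite abE vE uE c0 cats0.
Qed.

(** From zv = vz as words, the shorter of z and v is a prefix of the other. *)
Let commute_split z v : xword z -> z != [::] -> xword v -> reduced (z ++ v) ->
  commute (word_val z) (word_val v) ->
  (exists2 v', (v = z ++ v') & (size v' < size v)%N) \/
  (v = take (size v) z /\ (size v < size z)%N).
Proof.
move=> xz z0 xv redzv /(commute_cat xz xv redzv) zvE.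
have [le_zv|lt_vz] := leqP (size z) (size v); last first.
  right; split=> //; move/(congr1 (take (size v))): zvE.
  by rewrite (takel_cat _ (ltnW lt_vz)) take_size_cat // => ->.
left; exists (drop (size z) v).
  move/(congr1 (take (size z))): zvE.
  by rewrite take_size_cat // takel_cat // => {1}->; rewrite cat_take_drop.
by rewrite size_drop; case: (z) z0 le_zv => //= *; lia.
Qed.

(** The centraliser of a cyclically reduced g is, modulo the powers of g, covered
    by the finitely many proper prefixes of the words of g and g^-1: a longer
    element of the centraliser starts with one of these two words, which can be
    stripped off. Exponents stay natural numbers by putting powers of g on both
    sides. *)
Let commute_prefix u v : xword u -> u != [::] -> reduced (u ++ u) -> xword v ->
  commute (word_val u) (word_val v) ->
  exists a b t, [/\ t \in [seq take k w | w <- [:: u; winv u],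
                                          k <- iota 0 (size u)] &
    word_val u ^+ a * word_val v = word_val u ^+ b * word_val t].
Proof.
move=> xu u0 reduu; have [n] := ubnP (size v).
have size_winv : size (winv u) = size u by rewrite size_rev size_map.
have w0 : winv u != [::] by rewrite -size_eq0 size_winv size_eq0.
elim: n v => // n IHn v szv xv cuv.
(* If v cancelled against both u and its inverse, the first letter of v would
   be inverse to the last letter of u and equal to its first letter, against
   u ++ u being reduced. *)
have uv_or : reduced (u ++ v) \/ reduced (winv u ++ v).
  case: v xv {szv cuv} => [|l v] xv; first by left; rewrite cats0; case: xu.
  have [p [s uE]] : exists p s, u = p :: s by case: (u) u0 => // p s; exists p, s.
  have [s' [q uE']] : exists s q, u = rcons s q.
    by case/lastP: (u) u0 => // s' q; exists s', q.
  have pq : p != flip q.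
    by move: reduu; rewrite {1}uE' uE reduced_rcons_cons => /and3P[].
  have [lq|lq] := eqVneq l (flip q); [right|left]; last first.
    by rewrite uE' reduced_rcons_cons -uE' lq xu.1 xv.1.
  have wE : winv u = rcons (winv s) (flip p) by rewrite uE -cat1s winv_cat cats1.
  rewrite wE reduced_rcons_cons -wE (xword_winv xu).1 xv.1 flipK lq.
  by rewrite eq_sym pq.
case: uv_or => [reduv|redwv].
  have [[v' vE lt_v']|[vE lt_v]] := commute_split xu u0 xv reduv cuv.
    have uv'E : word_val v = word_val u * word_val v' by rewrite vE word_val_cat.
    have cuv' : commute (word_val u) (word_val v').
      by apply: (mulgI (word_val u)); rewrite -uv'E cuv uv'E mulgA.
    have [|||a [b [t [tu E]]]] := IHn v' => //; first exact: leq_trans lt_v' _.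
      by move: xv; rewrite vE => /xword_catr.
    exists a, b.+1, t; split=> //.
    by rewrite uv'E mulgA -expgSr !expgS -!mulgA E.
  exists 0%N, 0%N, v; split=> //; rewrite vE; apply/allpairsP.
  by exists (u, size v); split; rewrite ?mem_head // mem_iota.
have cwv : commute (word_val (winv u)) (word_val v).
  by rewrite word_val_winv; apply/commute_sym/commuteV.
have [[v' vE lt_v']|[vE lt_v]] := commute_split (xword_winv xu) w0 xv redwv cwv.
  have v'E : word_val v' = word_val u * word_val v.
    by rewrite vE word_val_cat word_val_winv mulVKg.
  have cuv' : commute (word_val u) (word_val v').
    by rewrite v'E; apply: commuteM.
  have [|||a [b [t [tu E]]]] := IHn v' => //; first exact: leq_trans lt_v' _.
    by move: xv; rewrite vE => /xword_catr.
  by exists a.+1, b, t; split=> //; rewrite expgSr -mulgA -v'E.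
exists 0%N, 0%N, v; split=> //; rewrite vE; apply/allpairsP.
exists (winv u, size v); split; rewrite ?in_cons ?eqxx ?orbT // mem_iota.
by rewrite -size_winv.
Qed.

(** Pigeonhole: two powers of h agree modulo powers of g = word_val u, since the
    centraliser has finitely many classes modulo g. *)
Let commute_cyclically_reduced u h :
  xword u -> u != [::] -> reduced (u ++ u) -> H h -> commute (word_val u) h ->
  exists n a b, (0 < n)%N /\ h ^+ n * word_val u ^+ a = word_val u ^+ b.
Proof.
move=> xu u0 reduu Hh cuh; set g := word_val u in cuh *.
have [H1 HM HV] := sgH.
set L := [seq take k w | w <- [:: u; winv u], k <- iota 0 (size u)].
have /choice[F FP] (j : nat) : exists abt : nat * nat * seq (gT * bool),
    abt.2 \in L /\ g ^+ abt.1.1 * h ^+ j = g ^+ abt.1.2 * word_val abt.2.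
  have Hhj : H (h ^+ j) by elim: j => // j IHj; rewrite expgS; apply: HM.
  have [v xv vE] := word_ex Hhj.
  have [|a [b [t [tL E]]]] := commute_prefix xu u0 reduu xv.
    by rewrite vE; apply: commuteX.
  by exists (a, b, t); rewrite -vE.
have [j [j' [lt_j Fj]]] : exists j j', (j < j')%N /\ (F j).2 = (F j').2.
  set s := [seq (F j).2 | j <- iota 0 (size L).+1].
  have : ~~ uniq s.
    apply/negP => us; suff : (size s <= size L)%N.
      by rewrite size_map size_iota ltnn.
    by apply: uniq_leq_size => // t /mapP[j _ ->]; have [] := FP j.
  move=> /(uniqPn [::])[i [j [ij sz E]]]; exists i, j; split=> //.
  move: sz E; rewrite size_map size_iota => sz.
  by rewrite !(nth_map 0%N) ?size_iota ?nth_iota //; apply: (ltn_trans ij).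
have [_ E] := FP j; have [_] := FP j'; rewrite -Fj.
move: (F j) (F j') E => [[a b] t] [[a' b'] t'] /= E E'.
exists (j' - j)%N, (a' + b)%N, (b' + a)%N; split; first by rewrite subn_gt0.
have cgh m k : commute (g ^+ m) (h ^+ k) by apply: commuteX2.
apply: (mulIg (h ^+ j)); rewrite -mulgA (cgh _ j) mulgA -expgnDr subnK 1?ltnW //.
rewrite -(cgh _ j') addnC expgnDr -mulgA E' mulgA -expgnDr addnC expgnDr.
by rewrite -mulgA -E mulgA -expgnDr.
Qed.

(** The conclusion is invariant under conjugation, so removing a letter and its
    inverse from the two ends of the word of g reduces to the cyclically reduced
    case. *)
Lemma commute_free_basis g h : H g -> g != 1 -> H h -> commute g h ->
  exists n a b, (0 < n)%N /\ h ^+ n * g ^+ a = g ^+ b.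
Proof.
move=> /word_ex[u xu <-{g}]; have [n] := ubnP (size u).
have [H1 HM HV] := sgH.
elim: n u h xu => // n IHn u h xu szu g1 Hh cuh.
have u0 : u != [::] by apply: contraNneq g1 => ->; rewrite /word_val big_nil.
have [reduu|Nreduu] := boolP (reduced (u ++ u)).
  exact: commute_cyclically_reduced reduu Hh cuh.
have {Nreduu} [l [s [uE s0]]] : exists l s,
    u = l :: rcons s (flip l) /\ s != [::].
  case: u xu u0 Nreduu {szu g1 cuh} => // l s xu _.
  case/lastP: s xu => [|s q] xu.
    rewrite -[_ ++ _]/([:: l; l]) reducedE /= andbT.
    by case: (l) => x b /=; rewrite xpair_eqE; case: b; rewrite andbF.
  rewrite -{1}rcons_cons reduced_rcons_cons rcons_cons xu.1 /= andbT negbK.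
  move=> /eqP lE; have qE : q = flip l by rewrite lE flipK.
  exists l, s; rewrite -qE; split=> //; apply: contraTneq xu.1 => ->.
  by rewrite reducedE /= qE eqxx.
have xl : xword [:: l] by move: xu; rewrite uE -cat1s => /xword_catl.
have xs : xword s.
  by move: xu; rewrite uE -cat1s => /xword_catr; rewrite -cats1 => /xword_catl.
pose x := word_val [:: l]; have Hx : H x := word_valH xl.
have gE : word_val s = word_val u ^ x.
  rewrite uE -cat1s -cats1 !word_val_cat -/x -[[:: flip l]]/(winv [:: l]).
  by rewrite word_val_winv -/x conjgE -!mulgA mulKg mulVg mulg1.
have [||||m [a [b [m0 E]]]] := IHn s (h ^ x) xs.
- by move: szu; rewrite uE /= size_rcons; lia.
- by rewrite gE conjg_eq1.
- by rewrite conjgE; apply/HM/HM => //; apply: HV.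
- by rewrite gE /commute -!conjMg cuh.
exists m, a, b; split=> //; apply: (conjg_inj x).
by rewrite conjMg !conjXg -gE.
Qed.

End Basis.
End FreeGroups.

(** * Powers, generated subgroups and classes of cyclic subgroups *)

Section GroupComplements.
Local Open Scope group_scope.
Variable gT : groupType.
Implicit Types (H X : set gT) (g h x : gT).

Lemma zexpg_subgroup H g m : is_subgroup H -> H g -> H (zexpg g m).
Proof.
move=> [H1 HM HV] Hg; have HX n : H (g ^+ n).
  by elim: n => // n IHn; rewrite expgS; apply: HM.
by case: m => n; [apply: HX|apply/HV/HX].
Qed.

Lemma conjg_zexpg g x m : (zexpg g m) ^ x = zexpg (g ^ x) m.
Proof. by case: m => n /=; rewrite ?conjVg conjXg. Qed.

Lemma commute_zexpg g m : commute g (zexpg g m).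
Proof. by case: m => n /=; rewrite -?expVgn; apply/commuteX => //; apply: commuteV. Qed.

Lemma generated_subgroup X : is_subgroup (generated X).
Proof.
split=> [H [[]]//|x y Xx Xy H [sgH XH]|x Xx H [sgH XH]].
  by have [_ HM _] := sgH; exact: HM (Xx _ (conj sgH XH)) (Xy _ (conj sgH XH)).
by have [_ _ HV] := sgH; exact: HV (Xx _ (conj sgH XH)).
Qed.

Lemma conj_class_cyclic_eq H h1 h2 : is_subgroup H ->
  conj_class H (cyclic_gen h1) = conj_class H (cyclic_gen h2) ->
  exists2 x, H x & exists m, h1 = (zexpg h2 m) ^ x.
Proof.
move=> [H1 _ _] E.
have : conj_class H (cyclic_gen h2) (cyclic_gen h1).
  rewrite -E; exists 1 => //; apply/seteqP; split=> [_ [y h1y <-]|y h1y].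
    by rewrite conjg1.
  by exists y; rewrite ?conjg1.
move=> [x Hx xE]; exists x => //.
have : cyclic_gen h1 h1 by exists 1%R.
by rewrite -xE => -[_ [m _ <-] <-]; exists m.
Qed.

End GroupComplements.

(** * Coordinates on PSL2 *)

Section PSL2Coordinates.
Variable K : numClosedFieldType.
Implicit Types (a b c d : K).

Lemma mulmx2 a b c d a' b' c' d' :
  mx2 a b c d *m mx2 a' b' c' d' =
  mx2 (a * a' + b * c') (a * b' + b * d') (c * a' + d * c') (c * b' + d * d').
Proof.
by apply/matrixP => i j; rewrite !mxE big_ord_recl big_ord1 !mxE /=;
  case: (i == 0); case: (j == 0).
Qed.

Lemma mx2_eqP a b c d a' b' c' d' :
  mx2 a b c d = mx2 a' b' c' d' <-> [/\ a = a', b = b', c = c' & d = d'].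
Proof.
split=> [/matrixP E|[-> -> -> ->]] //.
by have := (E 0 0, E 0 1, E 1 0, E 1 1); rewrite !mxE /= => -[[[-> ->] ->] ->].
Qed.

Lemma mx2N a b c d : - mx2 a b c d = mx2 (- a) (- b) (- c) (- d).
Proof. by apply/matrixP => i j; rewrite !mxE; case: ifP; case: ifP. Qed.

Lemma mx2_scalar a : a%:M = mx2 a 0 0 a.
Proof. by apply/matrixP => -[[|[|//]] ?] [[|[|//]] ?]; rewrite !mxE. Qed.

Lemma mx2_surj (M : 'M[K]_2) : M = mx2 (M 0 0) (M 0 1) (M 1 0) (M 1 1).
Proof.
apply/matrixP => -[[|[|//]] ?] [[|[|//]] ?]; rewrite !mxE /=;
  by congr (M _ _); apply: val_inj.
Qed.

Fact mx2_det a b c d : a * d - b * c = 1 -> \det (mx2 a b c d) == 1.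
Proof. by rewrite det_mx2 => ->. Qed.

(** The class of a matrix given by its entries: identities in PSL2 then reduce to
    polynomial identities between entries, up to a common sign (psl_eqP). *)
Definition psl a b c d (H : a * d - b * c = 1) : PSL2 K :=
  (\pi_(PSL2 K) (MkSL2 (mx2_det H)))%qT.

Lemma psl_eqP a b c d a' b' c' d' H H' :
  @psl a b c d H = @psl a' b' c' d' H' <->
  [/\ a = a', b = b', c = c' & d = d'] \/
  [/\ a = - a', b = - b', c = - c' & d = - d'].
Proof.
split=> [/eqP/PSL2_eqP|E]; first by rewrite /= mx2N !mx2_eqP.
by apply/eqP/PSL2_eqP; rewrite /= mx2N !mx2_eqP.
Qed.

Lemma psl_eq a b c d a' b' c' d' H H' :
  a = a' -> b = b' -> c = c' -> d = d' -> @psl a b c d H = @psl a' b' c' d' H'.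
Proof. by move=> ? ? ? ?; apply/psl_eqP; left. Qed.

Lemma psl_surj (g : PSL2 K) : exists a b c d H, g = @psl a b c d H.
Proof.
elim/quotW: g => A; have /eqP := SL2_det A; rewrite {1}[SL2_mx A]mx2_surj det_mx2 => H.
exists (SL2_mx A 0 0), (SL2_mx A 0 1), (SL2_mx A 1 0), (SL2_mx A 1 1), H.
by apply/eqP/PSL2_eqP; left; rewrite /= -mx2_surj.
Qed.

Fact psl1_det : 1 * 1 - 0 * 0 = 1 :> K. Proof. by ring. Qed.

Lemma psl1E : 1%g = psl psl1_det.
Proof. by apply/eqP/PSL2_eqP; left; rewrite /= mx2_scalar. Qed.

Fact pslM_det a b c d a' b' c' d' :
  a * d - b * c = 1 -> a' * d' - b' * c' = 1 ->
  (a * a' + b * c') * (c * b' + d * d') - (a * b' + b * d') * (c * a' + d * c') = 1.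
Proof. by move=> H H'; rewrite -[RHS]mulr1 -{1}H -H'; ring. Qed.

Lemma pslM a b c d a' b' c' d' H H' :
  (@psl a b c d H * @psl a' b' c' d' H')%g = psl (pslM_det H H').
Proof.
rewrite [LHS]PSL2_mulE; apply/eqP/PSL2_eqP; left.
by rewrite /= mulmx2.
Qed.

Fact pslV_det a b c d : a * d - b * c = 1 -> d * a - (- b) * (- c) = 1.
Proof. by move=> <-; ring. Qed.

Lemma pslV a b c d H : ((@psl a b c d H)^-1)%g = psl (pslV_det H).
Proof.
apply: mulg1_eq; rewrite pslM psl1E; apply: psl_eq; rewrite -?H; by ring.
Qed.

Fact lowU_det a : 1 * 1 - 0 * a = 1. Proof. by ring. Qed.
Definition lowU a : PSL2 K := psl (lowU_det a).

Fact upU_det a : 1 * 1 - a * 0 = 1. Proof. by ring. Qed.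
Definition upU a : PSL2 K := psl (upU_det a).

(** The half turn exchanging 0 and infinity, which carries upper unipotents to
    lower ones (upU_conj), so that only the latter need to be studied. *)
Fact half_turn_det : 0 * 0 - (- 1) * 1 = 1 :> K. Proof. by ring. Qed.
Definition half_turn : PSL2 K := psl half_turn_det.

Lemma gen_SE : gen_S K = lowU 1.
Proof. by apply/eqP/PSL2_eqP; left. Qed.

Lemma gen_TE l : gen_T l = upU (2 * l).
Proof. by apply/eqP/PSL2_eqP; left. Qed.

Lemma lowUD a b : lowU (a + b) = (lowU a * lowU b)%g.
Proof. by rewrite pslM; apply: psl_eq; ring. Qed.

Lemma lowU0 : lowU 0 = 1%g.
Proof. by rewrite psl1E; apply: psl_eq. Qed.

Lemma lowUN a : lowU (- a) = (lowU a)^-1%g.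
Proof. by rewrite pslV; apply: psl_eq; ring. Qed.

Lemma lowUMn a n : lowU (a *+ n) = (lowU a ^+ n)%g.
Proof. by elim: n => [|n IHn]; rewrite ?lowU0 // mulrS lowUD IHn expgS. Qed.

Lemma lowUMz a m : lowU (a *~ m) = zexpg (lowU a) m.
Proof. by case: m => n /=; rewrite ?lowUN -lowUMn // lowUN. Qed.

(** Used to rule out the minus sign in equalities of PSL2. *)
Lemma eqN_eq0 a : a = - a -> a = 0.
Proof. by move/eqP; rewrite -subr_eq0 opprK -mulr2n mulrn_eq0 /= => /eqP. Qed.

Lemma lowU_inj : injective lowU.
Proof.
move=> a b /psl_eqP[[]|[/eqN_eq0 /eqP]] //.
by rewrite oner_eq0.
Qed.

Lemma upU_conj b : upU b = (lowU (- b) ^ half_turn)%g.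
Proof.
apply: (mulgI half_turn); rewrite -conjgC !pslM; apply/psl_eqP; left.
by split; ring.
Qed.

Lemma parabolic_lowU a : a != 0 -> parabolic (lowU a).
Proof.
move=> a0; apply/parabolic_pi; split.
- by rewrite /= mx2_scalar; apply: contra_neq a0 => /mx2_eqP[].
- rewrite /= mx2_scalar mx2N; apply: contra_neq a0 => /mx2_eqP[_ _ -> _].
  by rewrite oppr0.
- by rewrite /mxtrace big_ord_recl big_ord1 !mxE /= expr2; ring.
Qed.

Lemma parabolic_upU a : a != 0 -> parabolic (upU a).
Proof.
move=> a0; apply/parabolic_pi; split.
- by rewrite /= mx2_scalar; apply: contra_neq a0 => /mx2_eqP[].
- rewrite /= mx2_scalar mx2N; apply: contra_neq a0 => /mx2_eqP[_ -> _ _].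
  by rewrite oppr0.
- by rewrite /mxtrace big_ord_recl big_ord1 !mxE /= expr2; ring.
Qed.

(** Comparing entries of g * lowU d and lowU d * g, the minus sign would make the
    first row of g vanish; the plus sign gives g = [a, 0; c, a] with a = +-1. *)
Lemma centralizer_lowU d (g : PSL2 K) :
  d != 0 -> commute g (lowU d) -> exists c, g = lowU c.
Proof.
move=> d0; have [a [b [c [e [H ->]]]]] := psl_surj g; rewrite /commute !pslM.
move=> /psl_eqP; rewrite !mulr1 !mulr0 !mul1r !mul0r !addr0 !add0r.
have eq0 x y z : x = y -> x - y = d * z -> z = 0.
  move=> -> /eqP; rewrite subrr eq_sym mulf_eq0 (negPf d0).
  by move/eqP.
case=> -[E1 E2 E3 E4].
  have b0 : b = 0 by apply: eq0 E1 _; ring.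
  have ea : e - a = 0 by apply: eq0 E3 _; ring.
  have /subr0_eq {}ea := ea.
  have /eqP : a ^+ 2 = 1 by rewrite -H b0 ea; ring.
  rewrite sqrf_eq1 => /orP[]/eqP aE.
    by exists c; apply: psl_eq; rewrite ?ea ?aE.
  by exists (- c); apply/psl_eqP; right; rewrite ea aE b0 oppr0 opprK.
have b0 : b = 0 by apply: eqN_eq0.
have a0 : a = 0 by apply: eqN_eq0; move: E1; rewrite b0 mul0r addr0.
have /eqP : 0 = 1 :> K by rewrite -H a0 b0; ring.
by rewrite eq_sym oner_eq0.
Qed.
End PSL2Coordinates.

(** * Divisibility among algebraic integers *)

Section AlgebraicIntegers.
Variable K : numClosedFieldType.
Implicit Types (a b c d x y t : K) (m n : int).

Definition algint x := integralOver (intr : int -> K) x.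

(** Divisibility with an algebraic integer as quotient; stated without a division
    so that it makes sense for every d. *)
Definition dvda d x := exists2 t, algint t & x = d * t.

Lemma algint_int m : algint m%:~R.
Proof. exact: (integral_id (intmul 1)). Qed.

Lemma algint0 : algint 0. Proof. exact: (algint_int 0). Qed.
Lemma algint1 : algint 1. Proof. exact: (algint_int 1). Qed.

Lemma algintN x : algint x -> algint (- x).
Proof. exact: (@integral_opp _ _ (intmul 1)). Qed.

Lemma algintD x y : algint x -> algint y -> algint (x + y).
Proof. exact: (@integral_add _ _ (intmul 1)). Qed.

Lemma algintB x y : algint x -> algint y -> algint (x - y).
Proof. exact: (@integral_sub _ _ (intmul 1)). Qed.

Lemma algintM x y : algint x -> algint y -> algint (x * y).
Proof. exact: (@integral_mul _ _ (intmul 1)). Qed.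

Lemma algintX x k : algint x -> algint (x ^+ k).
Proof.
by move=> Ox; elim: k => [|k IHk]; [apply: algint1|rewrite exprS; apply: algintM].
Qed.

Lemma algint_exp x k m : (0 < k)%N -> x ^+ k = m%:~R -> algint x.
Proof.
move=> k0 xk; exists ('X^k - m%:P); first exact: monicXnsubC.
by rewrite rmorphB /= map_polyXn map_polyC /= rootE !hornerE xk subrr.
Qed.

(** Conjugation fixes the integer coefficients of a monic equation for x. *)
Lemma algint_conj x : algint x -> algint x^*.
Proof.
move=> [p p_monic px]; exists p => //.
have <- : map_poly Num.conj (map_poly intr p) = map_poly intr p :> {poly K}.
  by rewrite -map_poly_comp; apply: eq_map_poly => m; rewrite /= rmorph_int.
by rewrite fmorph_root.
Qed.

(** A rational algebraic integer is an integer; this is known for algC, and the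
    monic equation of the quotient can be read there because the quotient is
    rational. *)
Lemma dvda_int m n : dvda m%:~R n%:~R -> (m %| n)%Z.
Proof.
have [->|m0] := eqVneq m 0.
  by move=> [t _ /eqP]; rewrite mul0r intr_eq0 => /eqP->.
move=> [t [p p_monic pt] nE]; pose r : rat := n%:~R / m%:~R.
have tE : t = ratr r.
  rewrite fmorph_div !rmorph_int nE mulrC mulKf //.
  by rewrite intr_eq0.
have pr : root (map_poly intr p : {poly rat}) r.
  move: pt; rewrite tE.
  have <- : map_poly ratr (map_poly intr p) = map_poly intr p :> {poly K}.
    by rewrite -map_poly_comp; apply: eq_map_poly => k; rewrite /= rmorph_int.
  by rewrite fmorph_root.
have Ar : ratr r \in Aint.
  apply: (@root_monic_Aint (map_poly intr p)).
  - have -> : map_poly intr p = map_poly ratr (map_poly intr p) :> {poly algC}.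
      by rewrite -map_poly_comp; apply: eq_map_poly => k; rewrite /= rmorph_int.
    by rewrite fmorph_root.
  - exact: monic_map.
  - by apply/polyOverP => i; rewrite coef_map /= intr_int.
have /intrP[k kE] := Cint_rat_Aint (Crat_rat r) Ar.
have {}kE : r = k%:~R by apply: (fmorph_inj (@ratr algC)); rewrite rmorph_int.
apply/dvdzP; exists k; apply: (@intr_inj rat).
by rewrite rmorphM /= -kE divfK // intr_eq0.
Qed.

Lemma dvda_algint d x : algint d -> dvda d x -> algint x.
Proof. by move=> Od [t Ot ->]; apply: algintM. Qed.

Lemma dvda0 d : dvda d 0.
Proof. by exists 0; rewrite ?mulr0 //; apply: algint0. Qed.

Lemma dvda1 x : algint x -> dvda 1 x.
Proof. by exists x; rewrite ?mul1r. Qed.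

Lemma dvdaa d : dvda d d.
Proof. by exists 1; rewrite ?mulr1 //; apply: algint1. Qed.

Lemma dvdaN d x : dvda d x -> dvda d (- x).
Proof. by move=> [t Ot ->]; exists (- t); rewrite ?mulrN //; apply: algintN. Qed.

Lemma dvdaD d x y : dvda d x -> dvda d y -> dvda d (x + y).
Proof.
by move=> [t Ot ->] [s Os ->]; exists (t + s); rewrite ?mulrDr //; apply: algintD.
Qed.

Lemma dvda_mulr d x y : dvda d x -> algint y -> dvda d (x * y).
Proof. by move=> [t Ot ->] Oy; exists (t * y); rewrite ?mulrA //; apply: algintM. Qed.

Lemma dvda_mull d x y : algint x -> dvda d y -> dvda d (x * y).
Proof. by move=> Ox dy; rewrite mulrC; apply: dvda_mulr. Qed.

Lemma dvdaMM d e x y : dvda d x -> dvda e y -> dvda (d * e) (x * y).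
Proof.
by move=> [t Ot ->] [s Os ->]; exists (t * s); [apply: algintM|rewrite mulrACA].
Qed.

Lemma dvdaX d x k : dvda d x -> dvda (d ^+ k) (x ^+ k).
Proof. by move=> [t Ot ->]; exists (t ^+ k); [apply: algintX|rewrite exprMn]. Qed.

Lemma dvda_conj d x : dvda d x -> dvda d^* x^*.
Proof. by move=> [t Ot ->]; exists t^*; [apply: algint_conj|rewrite rmorphM]. Qed.

End AlgebraicIntegers.

(** * Congruence subgroups *)

Section CongruenceSubgroups.
Variable K : numClosedFieldType.
Implicit Types (a b c d t : K) (g h x y : PSL2 K).

(** The principal congruence subgroup of level d of PSL2 over the algebraic
    integers; level 1 gives the whole group. *)
Definition Gamma d : set (PSL2 K) := [set g | exists a b c e H,
  g = @psl K a b c e H /\ [/\ dvda d (a - 1), dvda d b, dvda d c & dvda d (e - 1)]].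

Lemma Gamma_subgroup d : algint d -> is_subgroup (Gamma d).
Proof.
move=> Od; split=> [|g h|g].
- exists 1, 0, 0, 1, (psl1_det K); rewrite psl1E subrr; split=> //.
  by split; apply: dvda0.
- move=> [a [b [c [e [H [-> [da db dc de]]]]]]] [a' [b' [c' [e' [H' [-> [da' db' dc' de']]]]]]].
  have Oof (x : K) : dvda d (x - 1) -> algint x.
    by move=> dx; rewrite -[x](subrK 1); apply: algintD (algint1 K); apply: dvda_algint dx.
  have Oof0 (x : K) : dvda d x -> algint x := dvda_algint Od.
  rewrite pslM; eexists _, _, _, _, _; split; first reflexivity.
  split.
  + have -> : a * a' + b * c' - 1 = (a - 1) * a' + (a' - 1) + b * c' by ring.
    apply: dvdaD; last by apply: dvda_mulr; auto.
    by apply: dvdaD => //; apply: dvda_mulr; auto.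
  + by apply: dvdaD; [apply: dvda_mull|apply: dvda_mulr]; auto.
  + by apply: dvdaD; [apply: dvda_mulr|apply: dvda_mull]; auto.
  + have -> : c * b' + e * e' - 1 = (e - 1) * e' + (e' - 1) + c * b' by ring.
    apply: dvdaD; last by apply: dvda_mulr; auto.
    by apply: dvdaD => //; apply: dvda_mulr; auto.
- move=> [a [b [c [e [H [-> [da db dc de]]]]]]].
  rewrite pslV; eexists _, _, _, _, _; split; first reflexivity.
  by split=> //; apply: dvdaN.
Qed.

(** Writing g = 1 + N with N divisible by d, one has g^x = 1 + x^-1 N x. *)
Lemma Gamma_conj d g x : Gamma d g -> Gamma 1 x -> Gamma d (g ^ x)%g.
Proof.
move=> [a [b [c [e [H [-> [da db dc de]]]]]]] [p [q [r [s [H' [-> [dp dq dr ds]]]]]]].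
have Oof0 (y : K) : dvda 1 y -> algint y := dvda_algint (algint1 K).
have Oof (y : K) : dvda 1 (y - 1) -> algint y.
  by move=> dy; rewrite -[y](subrK 1); apply: algintD (algint1 K); apply: Oof0.
have Op := Oof _ dp; have Oq := Oof0 _ dq; have Or := Oof0 _ dr; have Os := Oof _ ds.
have lin (u v w z : K) : algint u -> algint v -> dvda d w -> dvda d z -> dvda d (u * w + v * z).
  by move=> Ou Ov dw dz; apply: dvdaD; apply: dvda_mull.
rewrite conjgE pslV !pslM; eexists _, _, _, _, _; split; first reflexivity.
split.
- have -> : s * (a * p + b * r) + - q * (c * p + e * r) - 1 =
     s * (p * (a - 1) + r * b) + - q * (p * c + r * (e - 1)) by rewrite -{1}H'; ring.
  by do ?[apply: (lin)]; rewrite //; apply: algintN.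
- have -> : s * (a * q + b * s) + - q * (c * q + e * s) =
     s * (q * (a - 1) + s * b) + - q * (q * c + s * (e - 1)) by ring.
  by do ?[apply: (lin)]; rewrite //; apply: algintN.
- have -> : - r * (a * p + b * r) + p * (c * p + e * r) =
     - r * (p * (a - 1) + r * b) + p * (p * c + r * (e - 1)) by ring.
  by do ?[apply: (lin)]; rewrite //; apply: algintN.
- have -> : - r * (a * q + b * s) + p * (c * q + e * s) - 1 =
     - r * (q * (a - 1) + s * b) + p * (q * c + s * (e - 1)) by rewrite -{1}H'; ring.
  by do ?[apply: (lin)]; rewrite //; apply: algintN.
Qed.

(** Two lifts differ by a sign, which does not affect divisibility. *)
Lemma Gamma_lowU d (x : K) : Gamma d (lowU x) <-> dvda d x.
Proof.
split=> [|dx]; last first.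
  exists 1, 0, x, 1, (lowU_det x); split=> //; rewrite subrr.
  by split => //; apply: dvda0.
move=> [a [b [c [e [H [/psl_eqP E [da db dc de]]]]]]].
by case: E => -[_ _ -> _] //; apply: dvdaN.
Qed.

Lemma Gamma1_half_turn : Gamma 1 (half_turn K).
Proof.
exists 0, (-1), 1, 0, (half_turn_det K); split=> //.
have d1 : dvda 1 (1 : K) by apply: dvdaa.
by rewrite sub0r; split=> //; apply: dvdaN.
Qed.

(** A root of a unipotent commutes with it, so it is a unipotent with the same
    fixed point, and taking the m-th power multiplies its corner by m. *)
Lemma dvda_zexpg_root d x g (m : int) : d != 0 -> Gamma 1 x -> Gamma 1 g ->
  (lowU d ^ x)%g = zexpg g m -> dvda m%:~R d.
Proof.
move=> d0 Gx Gg E; have sg1 := Gamma_subgroup (algint1 K).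
have {}E : lowU d = zexpg (g ^ x^-1)%g m by rewrite -conjg_zexpg -E conjgK.
have [c cE] : exists c, (g ^ x^-1)%g = lowU c.
  by apply: (centralizer_lowU d0); rewrite E; apply: commute_zexpg.
have /Gamma_lowU [t Ot ct] : Gamma 1 (lowU c).
  by rewrite -cE; apply: Gamma_conj => //; case: sg1 => _ _; apply.
exists t => //; apply: lowU_inj; rewrite E cE -lowUMz.
by rewrite ct mul1r mulrzl.
Qed.

(** Obstruction to conjugacy: the congruence subgroup of level d' is normal, so
    it contains all conjugates of powers of an element of corner d'. *)
Lemma dvda_conj_zexpg d d' x x' y (m : int) : algint d' ->
  Gamma 1 x -> Gamma 1 x' -> Gamma 1 y ->
  (lowU d ^ x)%g = (zexpg (lowU d' ^ x') m ^ y)%g -> dvda d' d.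
Proof.
move=> Od' Gx Gx' Gy E; have [_ _ GV] := Gamma_subgroup (algint1 K).
apply/Gamma_lowU; rewrite -[lowU d](conjgK x) E.
apply: Gamma_conj; last exact: GV; apply: Gamma_conj => //.
apply: zexpg_subgroup; first exact: Gamma_subgroup.
by apply: Gamma_conj => //; apply/Gamma_lowU/dvdaa.
Qed.

End CongruenceSubgroups.

(** * A divisibility criterion for parabolic dust *)

Section Dust.
Variable K : numClosedFieldType.
Implicit Types (G : set (PSL2 K)) (d : K) (x : PSL2 K).

Lemma primitive_lowU_conj G d x : G `<=` Gamma 1 -> G (lowU d ^ x)%g ->
  parabolic (lowU d ^ x)%g -> d != 0 -> Gamma 1 x ->
  (forall m : int, dvda m%:~R d -> m = 1 \/ m = -1) ->
  primitive_parabolic G (lowU d ^ x)%g.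
Proof.
move=> G1 Gh ph d0 Gx dP; split=> // g m Gg E.
by apply: dP; apply: dvda_zexpg_root E => //; apply: G1.
Qed.

Lemma parabolic_dust_levels G (d : nat -> K) (x : nat -> PSL2 K) :
  is_subgroup G -> G `<=` Gamma 1 ->
  (forall i, (i < 3)%N -> [/\ algint (d i), Gamma 1 (x i) &
    primitive_parabolic G (lowU (d i) ^ x i)%g]) ->
  (forall i k, (i < k < 3)%N -> ~ dvda (d k) (d i)) ->
  parabolic_dust G.
Proof.
move=> sgG G1 hP dP.
pose F i := conj_class G (cyclic_gen (lowU (d i) ^ x i)%g).
have Flt i k : (i < k < 3)%N -> F i <> F k.
  move=> ik Fik; apply: (dP i k ik); move: ik => /andP[ik k3].
  have [_ Gxi _] := hP i (ltn_trans ik k3); have [Od Gxk _] := hP k k3.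
  have [y Gy [m E]] := conj_class_cyclic_eq sgG Fik.
  exact: dvda_conj_zexpg Od Gxi Gxk (G1 _ Gy) E.
have Finj : {in `I_3 &, injective F}.
  move=> i k; rewrite !inE /= => i3 k3 Fik.
  have [ik|ki|//] := ltngtP i k.
    by case: (Flt i k); rewrite ?ik.
  by case: (Flt k i); rewrite ?ki.
rewrite /parabolic_dust -(card_le_eql (inj_card_eq Finj)).
apply: subset_card_le => _ [i i3 <-].
by exists (lowU (d i) ^ x i)%g => //; have [] := hP i i3.
Qed.

End Dust.

(** * Lower unipotent elements of the groups G_lambda *)

Section GLambda.
Variable K : numClosedFieldType.
Implicit Types (l a w j : K).

Lemma G_lambda_subgroup l : is_subgroup (G_lambda l).
Proof. exact: generated_subgroup. Qed.

Lemma G_lambda_S l : G_lambda l (lowU 1).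
Proof. by rewrite -gen_SE; apply: sub_gen_smallest; left. Qed.

Lemma G_lambda_T l : G_lambda l (upU (2 * l)).
Proof. by rewrite -gen_TE; apply: sub_gen_smallest; right. Qed.

Lemma G_lambda_sub l (P : set (PSL2 K)) :
  is_subgroup P -> P (lowU 1) -> P (upU (2 * l)) -> G_lambda l `<=` P.
Proof.
move=> sgP PS PT; apply: smallest_sub => // _ [->|->].
  by rewrite gen_SE.
by rewrite gen_TE.
Qed.

(** The conjugator sends the fixed point of the translation upU (2 * quad_map l)
    to that of T S T^-1 while fixing S. It exists because the two pairs of
    parabolics have the same trace invariant: tr ((S - 1) (T S T^-1 - 1)) is
    -(2l)^2 = 2 * quad_map l. *)
Lemma upU_quad_map l : l != 0 ->
  (upU (2 * quad_map l) ^ lowU (- (2 * l)^-1) = lowU 1 ^ (upU (2 * l))^-1)%g.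
Proof.
move=> l0; apply: (mulgI (lowU (- (2 * l)^-1))).
rewrite -conjgC conjgE invgK !pslV !pslM.
by apply: psl_eq; rewrite /quad_map; field.
Qed.

Lemma conj_lowU a b : (lowU a ^ lowU b)%g = lowU a.
Proof. by rewrite conjgE -lowUN -!lowUD; congr lowU; ring. Qed.

Lemma G_lambda_quad_map l a : l != 0 ->
  G_lambda (quad_map l) (lowU a) -> G_lambda l (lowU a).
Proof.
move=> l0 Ga; have [G1 GM GV] := G_lambda_subgroup l.
set x := lowU (- (2 * l)^-1).
suff : G_lambda (quad_map l) `<=` [set g | G_lambda l (g ^ x)%g].
  by move=> /(_ _ Ga); rewrite /= conj_lowU.
apply: G_lambda_sub => /=.
- split=> [|g h|g] /=; first by rewrite conj1g.
    by rewrite conjMg; apply: (GM).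
  by rewrite conjVg; apply: (GV).
- by rewrite conj_lowU; apply: G_lambda_S.
- rewrite upU_quad_map // conjgE invgK.
  apply: (GM); first exact: G_lambda_T.
  by apply: (GM); [apply: G_lambda_S|apply: (GV); apply: G_lambda_T].
Qed.

Lemma quad_map_neq0 l : l != 0 -> quad_map l != 0.
Proof. by move=> l0; rewrite mulf_neq0 ?oppr_eq0 ?pnatr_eq0 ?expf_neq0. Qed.

Lemma iter_quad_map_neq0 n l : l != 0 -> iter n (@quad_map K) l != 0.
Proof. by move=> l0; elim: n => //= n; apply: quad_map_neq0. Qed.

Lemma G_lambda_iter n l a : l != 0 ->
  G_lambda (iter n (@quad_map K) l) (lowU a) -> G_lambda l (lowU a).
Proof.
move=> l0; elim: n => //= n IHn Ga; apply: IHn.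
by apply: G_lambda_quad_map Ga; apply: iter_quad_map_neq0.
Qed.

(** In the coordinate r = 2l the quadratic map is r |-> - r^2. *)
Lemma iter_quad_mapE n l :
  2 * iter n.+1 (@quad_map K) l = - (2 * l) ^+ (2 ^ n.+1).
Proof.
elim: n => [|n IHn]; first by rewrite /= /quad_map; ring.
rewrite iterS /quad_map expnSr exprM -[X in _ = - X]sqrrN -IHn.
by ring.
Qed.

(** The Whitehead link relation: for w = 1 + j with j^2 = -1 this word commutes
    with S; it is a longitude of the cusp of S, with corner 1 - 2j. *)
Lemma longitude w : w ^+ 2 = 2 * w - 2 ->
  let S := lowU 1 in let T := upU w in
  (T * S^-1 * T^-1 * S * T^-1 * S^-1 * T)%g = lowU (3 - 2 * w).
Proof.
move=> w2 S T.
(* To verify p = q modulo the equation of w, exhibit the cofactor c. *)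
have rel p q c : p - q = c * (w ^+ 2 - (2 * w - 2)) -> p = q.
  by rewrite w2 subrr mulr0 => /subr0_eq.
have detA : (w - 1) * (1 + w) - (2 * w - 2) * w = 1 by apply: (rel _ _ (- 1)); ring.
have detB : (1 + w) * (1 - w) - (2 * w - 2) * (- 1) = 1 by apply: (rel _ _ (- 1)); ring.
(* The two halves of the word, with w ^+ 2 already reduced. *)
have AE : (T * S^-1 * T^-1 * S)%g = psl detA.
  by rewrite !pslV !pslM; apply: psl_eq;
    [apply: (rel _ _ 1)|apply: (rel _ _ 1)|apply: (rel _ _ 0)|apply: (rel _ _ 0)]; ring.
have BE : (T^-1 * (S^-1 * T))%g = psl detB.
  by rewrite !pslV !pslM; apply: psl_eq;
    [apply: (rel _ _ 0)|apply: (rel _ _ 1)|apply: (rel _ _ 0)|apply: (rel _ _ 0)]; ring.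
rewrite -mulgA -mulgA BE AE pslM; apply/psl_eqP; right.
by split; [apply: (rel _ _ 1)|apply: (rel _ _ 0)|apply: (rel _ _ 1)|apply: (rel _ _ 1)]; ring.
Qed.

(** Here (2l)^4 = -4, and X^4 + 4 = (X^2 - 2X + 2) (X^2 + 2X + 2); the second
    factor is reduced to the first by replacing T with its inverse. *)
Lemma exists_longitude l : (quad_map l) ^+ 2 = -1 ->
  exists2 j, j ^+ 2 = -1 & G_lambda l (lowU (1 - 2 * j)).
Proof.
move=> l2; have [G1 GM GV] := G_lambda_subgroup l.
have GS := @G_lambda_S l; have GT := @G_lambda_T l.
have word w : G_lambda l (upU w) -> w ^+ 2 = 2 * w - 2 ->
    exists2 j, j ^+ 2 = -1 & G_lambda l (lowU (1 - 2 * j)).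
  move=> Gw w2; exists (w - 1).
    have -> : (w - 1) ^+ 2 = w ^+ 2 - 2 * w + 1 by ring.
    by rewrite w2; ring.
  have -> : 1 - 2 * (w - 1) = 3 - 2 * w by ring.
  rewrite -longitude //.
  by do 6?apply: (GM) => //; apply: (GV).
have : ((2 * l) ^+ 2 - 2 * (2 * l) + 2) * ((2 * l) ^+ 2 + 2 * (2 * l) + 2) = 0.
  transitivity (4 * ((quad_map l) ^+ 2 + 1)); first by rewrite /quad_map; ring.
  by rewrite l2; ring.
move=> /eqP; rewrite mulf_eq0 => /orP[]/eqP E.
  by apply: (word (2 * l)) => //; apply/subr0_eq; rewrite -E; ring.
apply: (word (- (2 * l))); last by apply/subr0_eq; rewrite -E; ring.
have -> : upU (- (2 * l)) = (upU (2 * l))^-1%g; last exact: GV.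
by rewrite pslV; apply: psl_eq; ring.
Qed.

Lemma isomorphic_ZxZ_lowU a b :
  (forall m n : int, m%:~R * a + n%:~R * b = 0 -> m = 0 /\ n = 0) ->
  isomorphic_ZxZ [set lowU (p.1%:~R * a + p.2%:~R * b) | p in [set: int * int]].
Proof.
move=> ab_free; exists (fun p => lowU (p.1%:~R * a + p.2%:~R * b)); split.
  split=> [p _|p q _ _ /lowU_inj E|g [p _ <-]]; [by exists p| |by exists p].
  have [|p1 p2] := ab_free (p.1 - q.1) (p.2 - q.2).
    by rewrite !rmorphB /= !mulrBl addrACA -opprD E subrr.
  by case: p q p1 p2 {E} => [p1 p2] [q1 q2] /= /subr0_eq-> /subr0_eq->.
by move=> p q; rewrite -lowUD; congr lowU; rewrite /= !rmorphD /=; ring.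
Qed.

Lemma lowU_span_sub l a b : G_lambda l (lowU a) -> G_lambda l (lowU b) ->
  let H := [set lowU (p.1%:~R * a + p.2%:~R * b) | p in [set: int * int]] in
  is_subgroup H /\ H `<=` G_lambda l.
Proof.
move=> Ga Gb; have [G1 GM GV] := G_lambda_subgroup l.
split; last first.
  move=> _ [p _ <-]; rewrite lowUD !mulrzl !lowUMz.
  by apply: (GM); apply: (zexpg_subgroup _ (G_lambda_subgroup l)).
split=> [|_ _ [p _ <-] [q _ <-]|_ [p _ <-]].
- by exists (0, 0) => //; rewrite /= !mul0r addr0 lowU0.
- by exists (p + q) => //; rewrite -lowUD; congr lowU; rewrite /= !rmorphD /=; ring.
- by exists (- p) => //; rewrite -lowUN; congr lowU; rewrite /= !rmorphN /=; ring.
Qed.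

(** From m = - n j follows m^2 = - n^2. *)
Lemma gauss_indep j (m n : int) :
  j ^+ 2 = -1 -> m%:~R + n%:~R * j = 0 -> m = 0 /\ n = 0.
Proof.
move=> j2 E; suff mn : m ^+ 2 + n ^+ 2 = 0 by split; nia.
apply: (@intr_inj K); rewrite rmorphD !rmorphXn /=.
have -> : m%:~R = - (n%:~R * j) by apply/subr0_eq; rewrite opprK.
by rewrite sqrrN exprMn j2; ring.
Qed.

Lemma gauss_conj j : j ^+ 2 = -1 -> j^* = - j.
Proof.
move=> j2; have j1 : `|j| ^+ 2 = 1 by rewrite -normrX j2 normrN1.
have j0 : j != 0 by rewrite -normr_eq0 -sqrf_eq0 j1 oner_eq0.
by apply: (mulfI j0); rewrite -normCK j1 mulrN -expr2 j2; ring.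
Qed.

End GLambda.

(** * The three properties *)

Section Main.
Variable K : numClosedFieldType.

Lemma G_lambda_not_free (l j : K) :
  j ^+ 2 = -1 -> G_lambda l (lowU (1 - 2 * j)) -> ~ is_free (G_lambda l).
Proof.
move=> j2 Gu [X GX].
have S1 : lowU (1 : K) != 1%g.
  by apply/eqP; rewrite -lowU0 => /lowU_inj /eqP; rewrite oner_eq0.
have [|n [a [b [n0]]]] := commute_free_basis (G_lambda_subgroup l) GX
    (@G_lambda_S K l) S1 Gu.
  by rewrite /commute -!lowUD addrC.
rewrite -!lowUMn -lowUD => /lowU_inj E.
have := @gauss_indep K j (n%:Z + a%:Z - b%:Z) (- 2 * n%:Z) j2.
case.
  transitivity ((1 - 2 * j) *+ n + 1 *+ a - 1 *+ b); last by rewrite E subrr.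
  by rewrite !(rmorphB, rmorphD, rmorphM) /= -!pmulrn; ring.
by lia.
Qed.

(** The lattices of translations spanned by 1, u and by 1, 2u, for u = 1 - 2j. *)
Lemma G_lambda_ZxZ (l j : K) :
  j ^+ 2 = -1 -> G_lambda l (lowU (1 - 2 * j)) ->
  exists H1 H2 : set (PSL2 K),
        [/\ H1 <> H2,
            is_subgroup H1 /\ H1 `<=` G_lambda l,
            is_subgroup H2 /\ H2 `<=` G_lambda l,
            isomorphic_ZxZ H1 &
            isomorphic_ZxZ H2].
Proof.
move=> j2 Gu; have GS := @G_lambda_S K l.
pose H (b : K) := [set lowU (p.1%:~R * 1 + p.2%:~R * b) | p in [set: int * int]].
exists (H (1 - 2 * j)), (H (2 * (1 - 2 * j))); split.
- have Hu : H (1 - 2 * j) (lowU (1 - 2 * j)).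
    by exists (0, 1) => //; congr lowU; rewrite /=; ring.
  move=> E; move: Hu; rewrite E => -[[m n] _ /lowU_inj /= /eqP].
  rewrite -subr_eq0 => /eqP mn.
  have := @gauss_indep K j (m + 2 * n - 1) (2 - 4 * n) j2; case; last by lia.
  by rewrite !(rmorphB, rmorphD, rmorphM) /= -mn; ring.
- exact: lowU_span_sub.
- apply: lowU_span_sub => //; rewrite mulr_natl lowUMn.
  by have [_ GM _] := G_lambda_subgroup l; apply: (GM).
- apply: isomorphic_ZxZ_lowU => m n mn.
  have := @gauss_indep K j (m + n) (- 2 * n) j2; case; last by lia.
  by rewrite !(rmorphB, rmorphD, rmorphM, rmorphN) /= -mn; ring.
- apply: isomorphic_ZxZ_lowU => m n mn.
  have := @gauss_indep K j (m + 2 * n) (- 4 * n) j2; case; last by lia.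
  by rewrite !(rmorphB, rmorphD, rmorphM, rmorphN) /= -mn; ring.
Qed.

(** Any integer with |m| > 1 has |m|^N >= 2^N. *)
Lemma absz_dvd_pow (m k : int) (N : nat) :
  (0 < `|k| < 2 ^ N)%N -> (m ^+ N %| k)%Z -> m = 1 \/ m = -1.
Proof.
move=> /andP[k0 kN] mk.
have N0 : (0 < N)%N by case: N kN {mk} => //; rewrite expn0; lia.
have m0 : m != 0.
  apply/eqP => m0; move: mk; rewrite m0 expr0n gtn_eqF //= dvd0z => /eqP k_eq0.
  by rewrite k_eq0 in k0.
have : (`|m| < 2)%N.
  rewrite -(ltn_exp2r _ _ N0); apply: leq_ltn_trans kN.
  by move: mk; rewrite dvdzE abszX => /(dvdn_leq k0).
by lia.
Qed.

(** The three primitive parabolics are S, T and lowU u, with corners 1, r, u; the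
    norms r^N = -4 and u u^* = 5 turn the divisibilities to be excluded into
    divisibilities of integers. *)
Lemma G_lambda_dust (l j : K) (N : nat) : (3 <= N)%N -> (- (2 * l)) ^+ N = -4 ->
  j ^+ 2 = -1 -> G_lambda l (lowU (1 - 2 * j)) -> parabolic_dust (G_lambda l).
Proof.
move=> N3 rN j2 Gu; set r := - (2 * l); set u := 1 - 2 * j.
have N0 : (0 < N)%N by apply: leq_trans N3.
have r0 : r != 0.
  apply/eqP => r0; have /eqP := rN; rewrite -/r r0 expr0n gtn_eqF //.
  by rewrite eq_sym oppr_eq0 pnatr_eq0.
have Or : algint r by apply: (@algint_exp _ _ N (-4)).
have Oj : algint j by apply: (@algint_exp _ _ 2 (-1)).
have Ou : algint u.
  apply: algintB; first exact: algint1.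
  by apply: algintM => //; apply: (algint_int _ 2).
have uJ : u * u^* = 5.
  rewrite rmorphB rmorphM /= rmorph1 rmorph_nat gauss_conj //.
  by transitivity (1 - 4 * j ^+ 2); [rewrite /u; ring|rewrite j2; ring].
have u0 : u != 0.
  by apply/eqP => u0; have /eqP := uJ; rewrite u0 mul0r eq_sym pnatr_eq0.
have TE : upU (2 * l) = (lowU r ^ half_turn K)%g by rewrite upU_conj.
have sg1 := Gamma_subgroup (algint1 K); have [Gone _ _] := sg1.
have G1 : G_lambda l `<=` Gamma 1.
  apply: G_lambda_sub => //; first exact/Gamma_lowU/dvdaa.
  rewrite TE; apply: Gamma_conj; last exact: Gamma1_half_turn.
  exact/Gamma_lowU/dvda1.
pose d i := nth u [:: 1; r] i.
pose x i := if i == 1%N then half_turn K else 1%g.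
apply: (@parabolic_dust_levels _ _ d x) => //; first exact: G_lambda_subgroup.
  have prim1 c : c != 0 -> G_lambda l (lowU c) ->
      (forall m : int, dvda m%:~R c -> m = 1 \/ m = -1) ->
      primitive_parabolic (G_lambda l) (lowU c ^ 1)%g.
    move=> c0 Gc cP; apply: primitive_lowU_conj => //; rewrite conjg1 //.
    exact: parabolic_lowU.
  case=> [|[|[|//]]] _; rewrite /d /x /=; split=> //.
  - exact: algint1.
  - apply: prim1 => //; [exact: oner_neq0|exact: G_lambda_S|].
    by move=> m /(@dvda_int K m 1); rewrite dvdz1 => /eqP; lia.
  - exact: Gamma1_half_turn.
  - apply: primitive_lowU_conj => //.
    + by rewrite -TE; apply: G_lambda_T.
    + by rewrite -TE; apply: parabolic_upU; rewrite -oppr_eq0.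
    + exact: Gamma1_half_turn.
    + move=> m /(dvdaX N); rewrite rN -rmorphXn => /(@dvda_int K _ (-4)).
      apply: absz_dvd_pow => /=.
      by apply: leq_trans (leq_pexp2l _ N3).
  - apply: prim1 => // m mu; have /dvdaMM/(_ mu) := dvda_conj mu.
    rewrite [X in dvda _ X]mulrC uJ rmorph_int -rmorphM => /(@dvda_int K _ 5).
    rewrite dvdzE abszM /= => mm5; suff : absz m = 1%N by lia.
    have : (`|m| * `|m| <= 5)%N by apply: dvdn_leq.
    by case: (absz m) mm5 => [|[|[|k]]] //; lia.
move=> i k; rewrite /d; case: k => [|[|[|k]]]; rewrite ?ltn0 ?andbF //.
- case: i => //= _ /(dvdaX N); rewrite rN expr1n => /(@dvda_int K (-4) 1).
  by [].
- have conj5 (z : K) : dvda u z -> dvda 5 (z * z^*).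
    by move=> uz; rewrite -uJ; apply: dvdaMM => //; apply: dvda_conj.
  case: i => [|[|//]] _ /=.
    move=> /conj5; rewrite rmorph1 mulr1 => d51.
    by have : (5 %| 1)%Z by apply: (@dvda_int K).
  have rJ : r^* ^+ N = -4 by rewrite -rmorphXn rN rmorphN rmorph_nat.
  move=> /conj5/(dvdaX N); rewrite exprMn rN rJ.
  have -> : -4 * -4 = (16 : int)%:~R :> K by ring.
  have -> : 5 ^+ N = (5 ^+ N : int)%:~R :> K by rewrite rmorphXn.
  move=> /dvda_int.
  case: (N) N0 => // M _; rewrite exprS => /(dvdz_trans (dvdz_mulr _ (dvdzz 5))).
  by [].
Qed.
End Main.

Theorem corollary7p4 (R : realType) (lambda : R[i]) (n : nat)
    (lambda_neq0 : lambda != 0) (n_gt1 : (1 < n)%N)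
    (hn : iter n (@quad_map R[i]) lambda = 'i%C \/
          iter n (@quad_map R[i]) lambda = - 'i%C) :
  [/\ ~ is_free (G_lambda lambda),
      parabolic_dust (G_lambda lambda) &
      exists H1 H2 : set (PSL2 R[i]),
        [/\ H1 <> H2,
            is_subgroup H1 /\ H1 `<=` G_lambda lambda,
            is_subgroup H2 /\ H2 `<=` G_lambda lambda,
            isomorphic_ZxZ H1 &
            isomorphic_ZxZ H2]].
Proof.
have hi : (iter n (@quad_map R[i]) lambda) ^+ 2 = -1.
  by case: hn => ->; rewrite ?sqrrN sqr_i.
case: n n_gt1 hi {hn} => [//|n'] n'_gt0 hi.
have [j j2 /(G_lambda_iter lambda_neq0) Gu] := exists_longitude hi.
split; [exact: G_lambda_not_free Gu| |exact: G_lambda_ZxZ Gu].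
(* By iter_quad_mapE, (2 lambda)^(2^n) = - 2 f^n lambda = +-2i, whose square
   is -4. *)
apply: (G_lambda_dust (N := 2 ^ n'.+2)) Gu => //.
  by apply: (@leq_trans (2 ^ 2)) => //; rewrite leq_exp2l.
rewrite expnS exprM sqrrN -exprM -expnS expnSr exprM.
rewrite -[X in X ^+ 2]opprK -iter_quad_mapE sqrrN exprMn hi.
by ring.
Qed.
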